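(* For every positive integer $k$ and every invariant coloring $f:\mathcal{E}(\mathbf{N})\to\{0,1,\dots,k-1\}$, there exists an infinite increasing sequence $S$ of positive integers such that $f$ is constant on all (finite) non-empty subsets of $S$ of even cardinality, i.e. $f$ is constant on $\mathcal{E}(S)$.
   Context: $\mathbf{N}=\{0,1,2,\dots\}$. For a set $X\subseteq\mathbf{N}$, $\mathcal{E}(X)$ denotes the set of all finite non-empty subsets of $X$ with even cardinality; an increasing sequence is identified with the set of its terms. For $Y\in\mathcal{E}(\mathbf{N})$ with increasing enumeration $y_1<y_2<\dots<y_{2n}$, define the alternating sum of consecutive differences $$A(Y):=\sum_{i=1}^{n}(y_{2i}-y_{2i-1}).$$ A coloring $f:\mathcal{E}(\mathbf{N})\to\{0,1,\dots,k-1\}$ is called invariant if for all $Y,Z\in\mathcal{E}(\mathbf{N})$ with $A(Y)=A(Z)$ one has $f(Y)=f(Z)$. *)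

(* Defs.v *)
From mathcomp Require Import all_boot finmap.
From mathcomp Require Import classical_sets functions cardinality.

Set Implicit Arguments.
Unset Strict Implicit.
Unset Printing Implicit Defensive.

Local Open Scope fset_scope.
Local Open Scope classical_set_scope.

Definition even_subsets (X : set nat) : set {fset nat} :=
  [set Y : {fset nat} | [/\ [set` Y] `<=` X, Y != fset0 & ~~ odd #|` Y|]].

(* The increasing enumeration [y] is 0-based: summand [i] is the usual
   y_(2j) - y_(2j-1) with j = i + 1.  Truncated subtraction is harmless since
   [y] is sorted. *)
Definition alt_sum (Y : {fset nat}) : nat :=
  let y := sort leq Y in
  \sum_(i < #|` Y|./2) (nth 0 y i.*2.+1 - nth 0 y i.*2).

(* The set [even_subsets setT] is coerced to the corresponding subtype of
   [{fset nat}], so colorings take no value outside even non-empty sets. *)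
Definition coloring (k : nat) : Type := even_subsets setT -> 'I_k.

Definition invariant_coloring (k : nat) (f : coloring k) : Prop :=
  forall Y Z : even_subsets setT,
    alt_sum (val Y) = alt_sum (val Z) -> f Y = f Z.

Definition constant_on (k : nat) (f : coloring k) (X : set nat) : Prop :=
  exists c : 'I_k,
    forall Y : even_subsets setT, even_subsets X (val Y) -> f Y = c.

(* Main.v *)
Require Import Defs.
From mathcomp Require Import all_boot finmap.
From mathcomp Require Import boolp classical_sets functions cardinality filter.

Local Open Scope classical_set_scope.

(** Since an invariant color of [Y] is a function of [A(Y)], it suffices to find
    positive integers [x_0, x_1, ...] all of whose finite sums (over distinct
    indices) share a color: if [s_n = 1 + x_0 + ... + x_(n-1)], then [A(Y)] for
    [Y] included in the range of [s] is such a finite sum.  This is Hindman's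
    theorem, obtained from an ultrafilter [p] that is idempotent for the
    convolution induced by addition (Galvin-Glazer).  Closed sets of
    ultrafilters are encoded by the filters they contain in common, so that the
    minimal closed subsemigroup of the Ellis-Numakura argument becomes a maximal
    filter [F]; maximality is applied to the filters of [C p] and of
    [{q in C | q p = p}], where [C] is the set of ultrafilters refining [F] and
    [p] is in [C]. *)

(** * Convolution of filters and idempotent ultrafilters *)

Section Convolution.
Context {T : Type} (op : T -> T -> T).
Implicit Types (p u v F : set_system T) (A B : set T).

Definition shift p A : set T := [set a | p [set b | A (op a b)]].

Definition conv u v : set_system T := [set A | u (shift v A)].

(* That is, the ultrafilters refining [F] form a nonempty closed subsemigroup. *)
Definition subsemigroup_filter F :=
  ProperFilter F /\ forall u v, UltraFilter u -> UltraFilter v ->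
    F `<=` u -> F `<=` v -> F `<=` conv u v.

Lemma shiftS p A B : Filter p -> A `<=` B -> shift p A `<=` shift p B.
Proof. by move=> pF AB a; apply: filterS => b; apply: AB. Qed.

Lemma shiftI p A B : Filter p -> shift p A `&` shift p B `<=` shift p (A `&` B).
Proof. by move=> pF a [pA pB]; apply: filterI pA pB. Qed.

Lemma shiftT p : Filter p -> shift p setT = setT.
Proof. by move=> pF; apply/seteqP; split=> // a _; apply: filterT. Qed.

Lemma shift0 p : ProperFilter p -> shift p set0 = set0.
Proof. by move=> pF; apply/seteqP; split=> // a /filter_ex []. Qed.

Lemma conv_filter u v : Filter u -> Filter v -> Filter (conv u v).
Proof.
move=> uF vF; split; rewrite /conv /=.
- by rewrite shiftT //; apply: filterT.
- by move=> A B uA uB; apply: filterS (@filterI _ u _ _ _ uA uB); apply: shiftI.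
- by move=> A B AB; apply: (@filterS _ u); apply: shiftS.
Qed.

Lemma conv_proper u v : ProperFilter u -> ProperFilter v ->
  ProperFilter (conv u v).
Proof.
move=> uF vF; split; last exact: conv_filter.
by rewrite /conv /= shift0 //; apply: filter_not_empty.
Qed.

Lemma proper_setC F A : ProperFilter F -> F A -> F (~` A) -> False.
Proof. by move=> FF FA FnA; have [x []] := filter_ex (filterI FA FnA). Qed.

Lemma convA : associative op ->
  forall u v w, conv u (conv v w) = conv (conv u v) w.
Proof.
move=> opA u v w; apply/funext => A; rewrite /conv /shift /=.
by congr u; apply/funext => a; congr v; apply/funext => b; congr w;
  apply/funext => c; rewrite /= opA.
Qed.

(** If [A] is not in [F], the trace of [F] on the complement of [A] is proper, and an ultrafilter
    refining it omits [A]. *)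
Lemma filter_ultraP F A : Filter F ->
  (forall u, UltraFilter u -> F `<=` u -> u A) -> F A.
Proof.
move=> FF FA; apply: contrapT => nFA.
have WF : ProperFilter (within (~` A) F).
  split; last exact: within_filter.
  apply: contra_not nFA; rewrite /within /=; apply: (@filterS _ F) => a nnA.
  by apply: contrapT => nA; apply: nnA.
have [u [uU Wu]] := ultraFilterLemma WF.
apply: (@proper_setC u A).
  by apply: FA => // B FB; apply: Wu; apply: (@filterS _ F) FB.
by apply: Wu; apply: (@filterE _ F).
Qed.

(* The ultrafilters refining [lift F p v] are the [q] refining [F] such that
   [conv q p] refines [v]. *)
Definition lift F p v : set_system T :=
  filter_from [set AB | F AB.1 /\ v AB.2] (fun AB => AB.1 `&` shift p AB.2).

Section Lift.
Context F p v (FF : ProperFilter F) (pU : UltraFilter p) (vF : ProperFilter v).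
Hypothesis Fpv : conv F p `<=` v.

Lemma lift_proper : ProperFilter (lift F p v).
Proof.
apply: filter_from_proper => [|[A B] /= [FA vB]].
  apply: filter_from_filter; first by exists (setT, setT); split; apply: filterT.
  move=> [A B] [A' B'] /= [FA vB] [FA' vB'].
  exists (A `&` A', B `&` B'); first by split; apply: filterI.
  move=> a /= [[Aa A'a] pBB]; by split; split=> //; apply: (filterS (F := p)) pBB => b [].
(* If [A] misses [shift p B], then, [p] being ultra, the complement of [B] is in [conv F p], hence
   in [v]. *)
apply/set0P/eqP => AB0; apply: (@proper_setC v B) => //; apply: Fpv.
apply: filterS FA => a Aa.
have [pB|//] := in_ultra_setVsetC [set b | B (op a b)] pU.
by have : set0 a by rewrite -AB0.
Qed.

Lemma sub_lift : F `<=` lift F p v.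
Proof. by move=> A FA; exists (A, setT) => [|a []//]; split=> //; apply: filterT. Qed.

Lemma lift_shift A : v A -> lift F p v (shift p A).
Proof. by move=> vA; exists (setT, A) => [|a []//]; split=> //; apply: filterT. Qed.

End Lift.

(** Zorn's lemma: any two sets in the union of a chain lie in a common link, and an ultrafilter
    refining the union refines every link. *)
Lemma maximal_subsemigroup_filter F : subsemigroup_filter F ->
  exists G, [/\ subsemigroup_filter G, F `<=` G &
    forall H, subsemigroup_filter H -> G `<=` H -> H `<=` G].
Proof.
move=> SF.
(* Adding [F] by hand takes care of the empty chain. *)
pose P := [set X | subsemigroup_filter (X `|` F)].
have [C CP Ctot|G [PG Gmax]] := @Zorn_bigcup (set T) P; last first.
  exists (G `|` F); split=> // H SH GFH A HA; left.
  apply: contrapT => nGA; apply: (Gmax H); last first.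
    by rewrite /P /= setUidl // => B FB; apply: GFH; right.
  by split=> [B GB|HG]; [apply: GFH; left | apply: nGA; apply: HG].
set U := (X in P X); have [FF Fuv] := SF.
have UP A : (U `|` F) A ->
    exists X, [/\ subsemigroup_filter (X `|` F), X = set0 \/ C X & (X `|` F) A].
  case=> [[X CX XA]|FA].
    by exists X; split; [apply: CP | right | left].
  by exists set0; split; [rewrite set0U | left | right].
have UP2 A B : (U `|` F) A -> (U `|` F) B -> exists X,
    [/\ subsemigroup_filter (X `|` F), X = set0 \/ C X, (X `|` F) A & (X `|` F) B].
  move=> /UP[X [SX CX XA]] /UP[Y [SY CY YB]].
  have [XY|YX] : X `<=` Y \/ Y `<=` X.
    by case: CX CY => [->|CX] [->|CY]; [left | left | right | apply: Ctot].
  - by exists Y; split=> //; case: XA => ?; [left; apply: XY | right].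
  - by exists X; split=> //; case: YB => ?; [left; apply: YX | right].
have XU X : X = set0 \/ C X -> X `|` F `<=` U `|` F.
  by move=> CX; apply: setSU; case: CX => [->//|CX]; apply: bigcup_sup.
split=> [|u v uU vU Uu Uv A /UP[X [[_ Xuv] /XU XU' XA]]]; last first.
  by apply: Xuv XA => // B XB; [apply: Uu | apply: Uv]; apply: XU'.
split=> [/UP[X [[XF _] _ X0]]|]; first by case: (filter_not_empty _ X0).
split=> [|A B UA UB|A B AB /UP[X [[XF _] CX XA]]].
- by right; apply: filterT.
- have [X [[XF _] CX XA XB]] := UP2 _ _ UA UB.
  by apply: (XU _ CX); apply: filterI.
- by apply: (XU _ CX); apply: filterS XA.
Qed.

Theorem idempotent_ultrafilter (D : set T) : associative op ->
  D !=set0 -> (forall a b, D a -> D b -> D (op a b)) ->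
  exists p, [/\ UltraFilter p, p D & p `<=` conv p p].
Proof.
move=> opA [d Dd] Dop.
have [|F [[FF Fuv] DF Fmax]] := @maximal_subsemigroup_filter (globally D).
  split=> [|u v uU vU Du Dv A DA]; first exact: globally_properfilter Dd.
  apply: filterS (Du D _) => // a Da; apply: filterS (Dv D _) => // b Db.
  exact/DA/Dop.
have [p [pU Fp]] := ultraFilterLemma FF.
exists p; split=> //; first by apply/Fp/DF => a.
(* [conv F p] is the filter of [{conv q p | q refines F}], by lifting. *)
have convFp : conv F p `<=` F.
  have FFp : F `<=` conv F p.
    by move=> A FA; apply: (@filter_ultraP F) => u uU Fu; apply: (Fuv u p).
  apply: Fmax => //; split=> [|u v uU vU Fpu Fpv]; first exact: conv_proper.
  (* Writing products for [conv]: v = q p with [q] refining [F], so u v = (u q) p, where u q again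
     refines [F]. *)
  have [q [qU Fq]] := ultraFilterLemma (@lift_proper F p v FF pU _ Fpv).
  have <- : conv q p = v.
    apply: (@max_filter _ v vU) => [|A vA]; first exact: conv_proper.
    by apply: Fq; apply: lift_shift.
  rewrite convA // => A; apply: (Fuv u q) => //.
    exact: subset_trans Fpu.
  by apply: subset_trans Fq; apply: sub_lift.
(* [lift F p p] is the filter of [{q refining F | conv q p = p}]. *)
have Fpp : conv F p `<=` p by apply: subset_trans Fp.
have liftF : lift F p p `<=` F.
  have F_lift : F `<=` lift F p p by apply: sub_lift.
  apply: Fmax (F_lift); split=> [|u v uU vU Hu Hv]; first exact: lift_proper.
  have Fu : F `<=` u := subset_trans F_lift Hu.
  have Fv : F `<=` v := subset_trans F_lift Hv.
  have uvF : ProperFilter (conv u v) by apply: conv_proper.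
  (* That is, (u v) p = u (v p) = u p = p, checked on a single set. *)
  have uv_shift A : p A -> conv u v (shift p A).
    move=> pA; suff : conv (conv u v) p A by [].
    have v_shift : v (shift p A) by apply: Hv; apply: lift_shift.
    rewrite -convA //; apply: (@filterS _ u) (Hu _ (lift_shift F p p FF A pA)).
    move=> a /= pAa; apply: Hv; exact: lift_shift.
  move=> X [[A B] /= [FA pB]] ABX; apply: filterS ABX _.
  apply: filterI (uv_shift _ pB); exact: (Fuv u v).
by move=> A pA; apply/Fp/liftF/lift_shift.
Qed.

(** By idempotence a set [B] of [p] has an element [x] such that the set of [b] with [op x b] in [B]
    is in [p]; the next set is the intersection of [B] with it. *)
Lemma idempotent_ultrafilter_chain p A :
  UltraFilter p -> p `<=` conv p p -> p A ->
  exists (x : nat -> T) (B : nat -> set T), B 0 = A /\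
    forall n, [/\ B n (x n), B n.+1 `<=` B n &
      forall b, B n.+1 b -> B n (op (x n) b)].
Proof.
move=> pU pp pA; have [t _] := filter_ex pA.
have [B|g gP] := @choice (set T) (T * set T) (fun B xB => p B ->
    [/\ B xB.1, p xB.2, xB.2 `<=` B & forall b, xB.2 b -> B (op xB.1 b)]).
  (* Outside [p] the value is a dummy. *)
  have [pB|npB] := pselect (p B); last by exists (t, B).
  have [x [Bx pBx]] := filter_ex (filterI pB (pp _ pB)).
  exists (x, B `&` [set b | B (op x b)]) => _ /=.
  have pBB : p (B `&` [set b | B (op x b)]) by apply: filterI.
  by split=> // b [].
pose B n := iter n (fun B => (g B).2) A.
have pB n : p (B n) by elim: n => // n /gP[].
by exists (fun n => (g (B n)).1), B; split=> // n; have [] := gP _ (pB n).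
Qed.

End Convolution.

(** * Alternating sums of partial sums *)

Fixpoint pair_diff_sum (t : seq nat) : nat :=
  if t is a :: b :: t' then (b - a) + pair_diff_sum t' else 0.

Lemma pair_diff_sumE (t : seq nat) :
  \sum_(i < (size t)./2) (nth 0 t i.*2.+1 - nth 0 t i.*2) = pair_diff_sum t.
Proof.
have [n] := ubnP (size t); elim: n t => // n IHn [|a [|b t]] /=; rewrite ?big_ord0 //.
by rewrite ltnS => lt_t_n; rewrite big_ord_recl /= IHn // ltnW.
Qed.

Lemma alt_sumE (Y : {fset nat}) : alt_sum Y = pair_diff_sum (sort leq Y).
Proof. by rewrite -pair_diff_sumE size_sort. Qed.

Section PartialSums.
Variables (x : nat -> nat) (B : nat -> set nat).
Hypothesis Bx : forall n, B n (x n).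
Hypothesis BS : forall n, B n.+1 `<=` B n.
Hypothesis BD : forall n b, B n.+1 b -> B n (x n + b).

(** The leading 1 makes the term at index 0 positive. *)
Definition partial_sum n := 1 + \sum_(i < n) x i.

Lemma partial_sumS n : partial_sum n.+1 = partial_sum n + x n.
Proof. by rewrite /partial_sum big_ord_recr addnA. Qed.

Lemma partial_sum_homo : {homo partial_sum : m n / m <= n}.
Proof. by apply: homo_leq leq_trans _ => // n; rewrite partial_sumS leq_addr. Qed.

Lemma chain_sub m n : m <= n -> B n `<=` B m.
Proof.
move=> /subnK <-; elim: (n - m) => //= d IHd.
by rewrite addSn; apply: subset_trans IHd.
Qed.

(** The terms from [x (n - 1)] down to [x m] are added to [r] one by one, each stepping down one
    level of [B]; [r = 0] is the empty tail. *)
Lemma chain_diff m n r : m < n -> r = 0 \/ B n r ->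
  B m (partial_sum n - partial_sum m + r).
Proof.
move=> /subnK <-; elim: (n - _) r => [|d IHd] r rP.
  rewrite add0n in rP *; rewrite partial_sumS addKn.
  by case: rP => [->|/BD//]; rewrite addn0.
rewrite addSn in rP *; rewrite partial_sumS -addnBAC -?addnA; last first.
  by apply: partial_sum_homo; rewrite addnS -addSn leq_addl.
apply: IHd; right.
by case: rP => [->|/BD//]; rewrite addn0.
Qed.

(** After the first pair [a < b] the remaining indices exceed [b], so their sum is a legitimate tail
    in [B b], or empty. *)
Lemma chain_pair_diff_sum m (t : seq nat) : sorted ltn t -> ~~ odd (size t) ->
  t != [::] -> all (leq m) t -> B m (pair_diff_sum (map partial_sum t)).
Proof.
have [n] := ubnP (size t); elim: n t m => // n IHn [|a [|b t]] m //=.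
rewrite ltnS => lt_t_n.
rewrite negbK => /andP[ab bt] even_t _ /and3P[ma mb mt].
apply: (chain_sub _ _ ma); apply: chain_diff => //.
case: t lt_t_n bt even_t mt => [|c t] lt_t_n bt even_t mt; [by left | right].
apply: IHn => //; [exact: ltnW | exact: path_sorted bt |].
apply: sub_all (order_path_min ltn_trans bt) => i; exact: ltnW.
Qed.

End PartialSums.

Lemma partial_sum_ltn (x : nat -> nat) : (forall n, 0 < x n) ->
  {homo partial_sum x : m n / m < n}.
Proof.
move=> x0; apply: homo_ltn ltn_trans _ => n.
by rewrite partial_sumS -addn1 leq_add2l.
Qed.

Lemma range_seq (T U : eqType) (s : T -> U) (l : seq U) :
  {subset l <= [pred u | `[< range s u >]]} -> exists t, l = map s t.
Proof.
elim: l => [|u l IHl] ls; first by exists [::].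
have [|t ->] := IHl; first by move=> v lv; apply: ls; rewrite inE lv orbT.
have /asboolP[a _ <-] := ls u (mem_head _ _).
by exists (a :: t).
Qed.

(** * From an idempotent ultrafilter to the monochromatic sequence *)

Theorem theoremA (k : nat) (k_gt0 : 0 < k) (f : coloring k)
    (f_inv : invariant_coloring f) :
  exists s : nat -> nat,
    [/\ forall n, 0 < s n,
        forall m n, m < n -> s m < s n
      & constant_on f (range s)].
Proof.
(* Positivity excludes the principal ultrafilter at 0 and later makes the sequence strictly
   increasing. *)
have [|a b a0 b0|p [pU pD pp]] :=
    idempotent_ultrafilter addn [set n | 0 < n] addnA.
- by exists 1.
- by rewrite /= addn_gt0 a0.
(* A positive number that is no [alt_sum] lies vacuously in every class; by invariance any other
   lies in the class of its color. *)
pose class c : set nat :=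
  [set n | 0 < n /\ forall Y : even_subsets setT, alt_sum (val Y) = n -> f Y = c].
have [c pc] : exists c, p (class c).
  apply: contrapT => npc.
  have pn : \forall n \near p, forall c, ~ class c n.
    apply: filter_forall => c.
    by have [pc|//] := in_ultra_setVsetC (class c) pU; case: npc; exists c.
  have [n [n0 nn]] := filter_ex (filterI pD pn).
  have [[Y Yn]|nY] := pselect (exists Y : even_subsets setT, alt_sum (val Y) = n).
    by apply: (nn (f Y)); split=> // Z Zn; apply: f_inv; rewrite Zn.
  by apply: (nn (Ordinal k_gt0)); split=> // Y Yn; case: nY; exists Y.
have [x [B [B0 xB]]] := idempotent_ultrafilter_chain addn p _ pU pp pc.
have Bx n : B n (x n) by have [] := xB n.
have BS n : B n.+1 `<=` B n by have [] := xB n.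
have BD n b : B n.+1 b -> B n (x n + b) by have [_ _] := xB n; apply.
have x0 n : 0 < x n.
  by have := chain_sub _ BS _ _ (leq0n n) _ (Bx n); rewrite B0 => -[].
have s_ltn := partial_sum_ltn x x0.
exists (partial_sum x); split=> //; exists c => Y [Ys Y0 Yeven].
suff : class c (alt_sum (val Y)) by case=> _; apply.
have [t tE] : exists t, sort leq (val Y) = map (partial_sum x) t.
  by apply: range_seq => y; rewrite mem_sort => /Ys /asboolP.
have size_t : size t = #|` val Y| by rewrite -(size_map (partial_sum x)) -tE size_sort.
rewrite alt_sumE tE -B0; apply: chain_pair_diff_sum => //.
- have : sorted ltn (sort leq (val Y)).
    by rewrite ltn_sorted_uniq_leq sort_uniq fset_uniq sort_sorted //; apply: leq_total.
  by rewrite tE sorted_map; apply: sub_sorted => i j /=; rewrite (leqW_mono (leq_mono s_ltn)).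
- by rewrite size_t.
- by rewrite -size_eq0 size_t cardfs_eq0.
- exact/allP.
Qed.
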